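(* For every integer $n\geqslant 5$, the convex polytope graph $R_n''$ satisfies $$\gamma_{2\text{-SRD}}(R_n'')=\left\lceil \frac{2|V(R_n'')|}{3}\right\rceil=4n.$$
   Context: For $n\geqslant 5$, $R_n''$ is the graph with vertex set $\{a_i,b_i,c_i,d_i,e_i,f_i : i\in\{0,\ldots,n-1\}\}$ ($6n$ distinct vertices) and edge set $\{a_ia_{i+1},\ f_if_{i+1},\ a_ib_i,\ b_ic_i,\ c_id_i,\ d_ie_i,\ e_if_i,\ b_{i+1}c_i,\ d_ie_{i+1} : i\in\{0,\ldots,n-1\}\}$, with indices taken modulo $n$. All graphs are finite, simple and undirected; $N(v)$ denotes the set of neighbors of $v$ and $\Delta(G)$ the maximum degree. Let $k\geqslant 1$ be an integer with $|V(G)|\geqslant k$. An attack pattern is a set $P\subseteq V(G)$ with $|P|=k$. A function $f:V(G)\to\{0,1,\ldots,\min(\Delta(G),k)+1\}$ is a proper $k$-SRD ($k$-strong Roman domination) function if for each attack pattern $P$ every vertex $u\in P$ with $f(u)=0$ can be defended by a neighboring vertex, where each vertex $v$ with $f(v)\geqslant 2$ can defend at most $f(v)-1$ of its neighbors in $P$ labeled 0 (and vertices with label $\leqslant 1$ defend no other vertex). That is, for each $P$ there is a map $\delta_P:\{u\in P : f(u)=0\}\to V(G)$ (which may depend on $P$) such that $\delta_P(u)\in N(u)$ and $f(\delta_P(u))\geqslant 2$ for all $u$ in its domain, and $|\delta_P^{-1}(v)|\leqslant f(v)-1$ for every $v$ with $f(v)\geqslant 2$. The weight is $\omega(f)=\sum_{v\in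 V(G)}f(v)$, and the $k$-SRD number is $\gamma_{k\text{-SRD}}(G)=\min\{\omega(f) : f \text{ is a proper } k\text{-SRD function on } G\}$. Here $k=2$. *)

(* Defs.v *)
From HB Require Import structures.
From mathcomp Require Import all_boot all_order all_algebra.

Set Implicit Arguments.
Unset Strict Implicit.
Unset Printing Implicit Defensive.

Record sgraph := SGraph {
  vertices :> finType;
  adj : rel vertices;
  adj_sym : symmetric adj;
  adj_irrefl : irreflexive adj
}.

Section StrongRomanDomination.

Variables (k : nat) (G : sgraph).

Definition neighbors (v : G) : {set G} := [set u | adj v u].

Definition max_degree : nat := \max_(v : G) #|neighbors v|.

(* The values of a labeling are 0, 1, ..., min(Delta(G), k) + 1. *)
Definition labeling := {ffun G -> 'I_(minn max_degree k).+2}.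

Definition attacked_zeros (f : labeling) (P : {set G}) : {set G} :=
  [set u in P | f u == 0 :> nat].

(* delta is a total function on G, but only its values on attacked_zeros f P
   matter: it stands for a map with domain {u in P | f u = 0}. *)
Definition defends (f : labeling) (P : {set G}) (delta : {ffun G -> G}) : bool :=
  [forall u in attacked_zeros f P,
     (delta u \in neighbors u) && (2 <= f (delta u))] &&
  [forall v : G, (2 <= f v) ==>
     (#|[set u in attacked_zeros f P | delta u == v]| <= f v - 1)].

Definition proper_SRD (f : labeling) : bool :=
  [forall P : {set G}, (#|P| == k) ==>
     [exists delta : {ffun G -> G}, defends f P delta]].

Definition weight (f : labeling) : nat := \sum_(v : G) f v.

Definition all_ones : labeling := [ffun=> lift ord0 ord0].

Lemma all_onesE (v : G) : all_ones v = 1 :> nat.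
Proof. by rewrite ffunE. Qed.

Lemma all_ones_proper : proper_SRD all_ones.
Proof.
apply/forallP => P; apply/implyP => _; apply/existsP; exists [ffun v => v].
by apply/andP; split; apply/forallP => v; rewrite ?inE all_onesE ?andbF.
Qed.

(* all_ones only witnesses that the minimum is over a nonempty set. *)
Definition gammaSRD : nat :=
  weight [arg min_(f < all_ones | proper_SRD f) weight f].

Lemma gammaSRD_attained : exists2 f, proper_SRD f & weight f = gammaSRD.
Proof.
rewrite /gammaSRD; case: arg_minnP => [|f pf _]; first exact: all_ones_proper.
by exists f.
Qed.

Lemma gammaSRD_min (f : labeling) : proper_SRD f -> gammaSRD <= weight f.
Proof.
rewrite /gammaSRD; case: arg_minnP => [|g _ min_g]; first exact: all_ones_proper.
exact: min_g.
Qed.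

End StrongRomanDomination.

Arguments neighbors {G} v.

Variant layer := La | Lb | Lc | Ld | Le | Lf.

Definition nat_of_layer (l : layer) : nat :=
  match l with La => 0 | Lb => 1 | Lc => 2 | Ld => 3 | Le => 4 | Lf => 5 end.

Definition layer_of_nat (m : nat) : option layer :=
  nth None [:: Some La; Some Lb; Some Lc; Some Ld; Some Le; Some Lf] m.

Lemma nat_of_layerK : pcancel nat_of_layer layer_of_nat.
Proof. by case. Qed.

HB.instance Definition _ := Countable.copy layer (pcan_type nat_of_layerK).

Lemma layer_enumP : Finite.axiom [:: La; Lb; Lc; Ld; Le; Lf].
Proof. by case. Qed.

HB.instance Definition _ := isFinite.Build layer layer_enumP.

Section Rpp.

Variable n : nat.

Definition Rpp_vertex : finType := (layer * 'I_n)%type.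

(* ordS i is i + 1 modulo n. *)
Definition Rpp_edges (i : 'I_n) : seq (Rpp_vertex * Rpp_vertex) :=
  [:: ((La, i), (La, ordS i));
      ((Lf, i), (Lf, ordS i));
      ((La, i), (Lb, i));
      ((Lb, i), (Lc, i));
      ((Lc, i), (Ld, i));
      ((Ld, i), (Le, i));
      ((Le, i), (Lf, i));
      ((Lb, ordS i), (Lc, i));
      ((Ld, i), (Le, ordS i))].

(* The test x != y only removes the loops that the edge list has when n = 1. *)
Definition Rpp_adj : rel Rpp_vertex := fun x y =>
  (x != y) &&
  [exists i : 'I_n, ((x, y) \in Rpp_edges i) || ((y, x) \in Rpp_edges i)].

Lemma Rpp_adj_sym : symmetric Rpp_adj.
Proof.
move=> x y; rewrite /Rpp_adj eq_sym; congr andb.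
by apply: eq_existsb => i; rewrite orbC.
Qed.

Lemma Rpp_adj_irrefl : irreflexive Rpp_adj.
Proof. by move=> x; rewrite /Rpp_adj eqxx. Qed.

Definition Rpp : sgraph := SGraph Rpp_adj_sym Rpp_adj_irrefl.

End Rpp.

(* Main.v *)
(** Lower bound, valid for every graph of maximum degree at most 3: each vertex
    labeled at least 2 sends charge 2/3 to every neighbor labeled 0 that it
    alone can defend, and 1/3 to its other neighbors labeled 0.  A vertex
    labeled 2 is the only defender of at most one vertex, since an attack on
    two such vertices would defeat it; hence afterwards every vertex holds at
    least 2/3, and the weight is at least 2|V|/3.
    Upper bound: label all b_i and e_i with 2 and everything else with 0. *)
Require Import Defs.
From mathcomp Require Import all_boot all_order all_algebra.
From mathcomp Require Import zify.

Set Implicit Arguments.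
Unset Strict Implicit.
Unset Printing Implicit Defensive.

Lemma card_neighbors_le (G : sgraph) (v : G) : #|neighbors v| <= max_degree G.
Proof. exact: (leq_bigmax v). Qed.

Section LowerBound.

Variables (G : sgraph) (f : labeling 2 G).

Definition defenders (u : G) : {set G} := [set v in neighbors u | 2 <= f v].

Definition private_zeros (v : G) : {set G} :=
  [set u in neighbors v | (f u == 0 :> nat) && (#|defenders u| == 1)].

(* Charges are counted in units of 1/3. *)
Definition charge (v u : G) : nat :=
  ((u \in neighbors v) && (f u == 0 :> nat) && (2 <= f v)) *
  (1 + (#|defenders u| == 1)).

Hypothesis f_proper : proper_SRD f.

(** An attack has exactly two vertices, so [u] is completed by some other vertex [w]; the defense of
    [[set w; u]] must supply a defender of [u]. *)
Lemma defenders_gt0 (u : G) : 1 < #|G| -> f u = 0 :> nat -> 0 < #|defenders u|.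
Proof.
move=> G_gt1 fu0.
have [w wu] : exists w, w != u.
  apply/existsP; rewrite -negb_forall; apply/negP => /forallP all_u.
  move: G_gt1; rewrite ltnNge => /negP; apply.
  rewrite -(card1 u); apply: subset_leq_card; apply/subsetP => x _.
  by rewrite inE all_u.
move/forallP/(_ [set w; u]): f_proper; rewrite cards2 wu /=.
case/existsP => d /andP[/forallP/(_ u) + _].
rewrite !inE eqxx orbT fu0 /= => /andP[adj_u f2].
by apply/card_gt0P; exists (d u); rewrite !inE adj_u.
Qed.

Lemma charge_in_ge2 (u : G) :
  1 < #|G| -> f u = 0 :> nat -> 2 <= \sum_v charge v u.
Proof.
move=> G_gt1 fu0; have := defenders_gt0 G_gt1 fu0.
(* The factor [1 + (#|defenders u| == 1)] does not depend on [v]. The sum is thus the number of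
   defenders times this factor: a sole defender pays 2, several pay 1 each. *)
rewrite -big_distrl /=.
have -> : \sum_v ((u \in neighbors v) && (f u == 0 :> nat) && (2 <= f v) : nat)
          = #|defenders u|.
  rewrite -sum1_card [RHS]big_mkcond /=; apply: eq_bigr => v _.
  by rewrite !inE adj_sym fu0 andbT; case: (_ && _).
by case: #|defenders u| => [|[|m]] //= _; lia.
Qed.

Lemma private_zeros_le1 (v : G) : f v = 2 :> nat -> #|private_zeros v| <= 1.
Proof.
move=> fv2; rewrite leqNgt; apply/negP => /card_gt1P[u [w [uP wP uw]]].
move/forallP/(_ [set u; w]): f_proper; rewrite cards2 uw /=.
case/existsP => d /andP[/forallP def_ok /forallP/(_ v)]; rewrite fv2 /=.
(* A private zero of [v] has no defender but [v], so any defense of the attack sends it to [v]. *)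
have dE x : x \in private_zeros v -> x \in [set u; w] -> d x = v.
  rewrite !inE => /and3P[vx fx0 /eqP/eq_leq/card_le1P dx1] xP.
  have := def_ok x; rewrite !inE xP fx0 /= => /andP[xd fd2].
  have vD : v \in defenders x by rewrite !inE adj_sym vx fv2.
  by apply/eqP; have := dx1 v vD (d x); rewrite !inE xd fd2 /= => <-.
rewrite leqNgt => /negP; apply; apply/card_gt1P; exists u, w.
have [fu0 fw0] : (f u == 0 :> nat) /\ (f w == 0 :> nat).
  by move: uP wP; rewrite !inE => /and3P[_ -> _] /and3P[_ -> _].
by split=> //; rewrite !inE ?fu0 ?fw0 eqxx ?orbT /= dE // !inE eqxx ?orbT.
Qed.

(** One unit at most goes to each neighbor, and a second one only to private zeros. *)
Lemma charge_out_le (v : G) :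
  \sum_u charge v u <= (2 <= f v) * (#|neighbors v| + #|private_zeros v|).
Proof.
rewrite -!sum1_card [X in _ * (X + _)]big_mkcond [X in _ * (_ + X)]big_mkcond.
rewrite -big_split big_distrr /=; apply: leq_sum => u _.
rewrite /charge [u \in private_zeros v]inE.
by case: (u \in _); case: (f u == _ :> nat); case: (2 <= f v); case: (_ == 1).
Qed.

Lemma private_zeros_le_neighbors (v : G) : #|private_zeros v| <= #|neighbors v|.
Proof. by apply: subset_leq_card; apply/subsetP => u; rewrite inE => /andP[]. Qed.

Lemma weight_ge : 1 < #|G| -> max_degree G <= 3 -> 2 * #|G| <= 3 * weight f.
Proof.
move=> G_gt1 deg3.
(* By label: 0 sends nothing and receives at least 2; 1 keeps 3; 2 keeps at least 6 - (3 + 1) = 2; a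
   label of 3 or more keeps at least 9 - (3 + 3) = 3. *)
have local v : 2 + \sum_u charge v u <= 3 * f v + \sum_u charge u v.
  have := charge_out_le v.
  have N3 := leq_trans (card_neighbors_le v) deg3.
  have PN := private_zeros_le_neighbors v.
  have [fv0|] := eqVneq (f v : nat) 0.
    by have := charge_in_ge2 G_gt1 fv0; rewrite fv0; lia.
  have [/private_zeros_le1|] := eqVneq (f v : nat) 2; first by lia.
  by case: (leqP 2 (f v)); lia.
have : \sum_v (2 + \sum_u charge v u) <= \sum_v (3 * f v + \sum_u charge u v).
  exact: leq_sum.
have -> : 3 * weight f = \sum_v 3 * f v by rewrite /weight big_distrr.
(* Total charge sent equals total charge received, so the two double sums cancel. *)
by rewrite !big_split /= sum_nat_const exchange_big /= leq_add2r mulnC.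
Qed.

End LowerBound.

Lemma index_enum_layer : index_enum layer = [:: La; Lb; Lc; Ld; Le; Lf].
Proof. by rewrite [index_enum _]unlock unlock. Qed.

Section Rpp.

Variable n : nat.

Lemma card_Rpp : #|Rpp n| = 6 * n.
Proof. by rewrite card_prod card_ord [#|{: layer}|]cardT enumT unlock. Qed.

Definition Rpp_neighbors (v : Rpp n) : seq (Rpp n) :=
  let i := v.2 in
  match v.1 with
  | La => [:: (La, ordS i); (La, ord_pred i); (Lb, i)]
  | Lb => [:: (La, i); (Lc, i); (Lc, ord_pred i)]
  | Lc => [:: (Lb, i); (Lb, ordS i); (Ld, i)]
  | Ld => [:: (Lc, i); (Le, i); (Le, ordS i)]
  | Le => [:: (Ld, i); (Ld, ord_pred i); (Lf, i)]
  | Lf => [:: (Lf, ordS i); (Lf, ord_pred i); (Le, i)]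
  end.

Lemma Rpp_adj_neighbors (u v : Rpp n) : adj u v -> v \in Rpp_neighbors u.
Proof.
case/andP => _ /existsP[i]; rewrite !inE.
case/orP; do ?[case/orP]; case/eqP => -> ->;
  by rewrite !inE ?ordSK ?eqxx ?orbT.
Qed.

Lemma max_degree_Rpp : max_degree (Rpp n) <= 3.
Proof.
apply/bigmax_leqP => v _.
apply: (@leq_trans (size (Rpp_neighbors v))); last by case: v => [[] i].
apply: leq_trans (card_size _); apply: subset_leq_card; apply/subsetP => u.
by rewrite inE; apply: Rpp_adj_neighbors.
Qed.

Lemma Rpp_edge_adj (i : 'I_n) (u v : Rpp n) :
  u != v -> ((u, v) \in Rpp_edges i) || ((v, u) \in Rpp_edges i) ->
  v \in neighbors u.
Proof.
by move=> uv e; rewrite inE /= /Rpp_adj uv; apply/existsP; exists i.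
Qed.

Definition is_be (v : Rpp n) : bool :=
  match v.1 with Lb | Le => true | _ => false end.

Definition be_labeling : labeling 2 (Rpp n) :=
  [ffun v => if is_be v then inord 2 else ord0].

Lemma be_labelingE (v : Rpp n) : be_labeling v = (is_be v).*2 :> nat.
Proof.
rewrite ffunE; case: ifP => // _; rewrite inordK //.
(* [inord 2] is 2 only if the label range contains 2, that is, if the maximum degree is positive;
   the edge from [a_i] to [b_i] shows this. *)
case: v => _ i; rewrite ltnS ltnS leq_min andbT.
apply: leq_trans (card_neighbors_le ((La, i) : Rpp n)).
apply/card_gt0P; exists (Lb, i).
by apply: (Rpp_edge_adj (i := i)); rewrite // !inE eqxx ?orbT.
Qed.

Lemma weight_be_labeling : weight be_labeling = 4 * n.
Proof.
rewrite /weight (eq_bigr (fun v => (is_be v).*2)); last first.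
  by move=> v _; exact: be_labelingE.
rewrite -(pair_bigA _ (fun l i => (is_be (l, i)).*2)) /=.
rewrite index_enum_layer !big_cons big_nil /= !sum_nat_const card_ord.
lia.
Qed.

(* c_i and d_i have two defenders; they leave the first one to a_i resp. f_i
   when the latter is attacked too. *)
Definition be_defense (P : {set Rpp n}) (v : Rpp n) : Rpp n :=
  let i := v.2 in
  match v.1 with
  | La | Lb => (Lb, i)
  | Lc => (Lb, if (La, i) \in P then ordS i else i)
  | Ld => (Le, if (Lf, i) \in P then ordS i else i)
  | Le | Lf => (Le, i)
  end.

Lemma ordS_neq (i : 'I_n) : 1 < n -> ordS i != i.
Proof.
move=> n_gt1; rewrite -val_eqE /=; have := ltn_ord i.
rewrite leq_eqVlt => /predU1P[i_last|lt_i].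
  by rewrite i_last modnn; lia.
by rewrite modn_small //; lia.
Qed.

Lemma be_labeling_proper : 1 < n -> proper_SRD be_labeling.
Proof.
move=> n_gt1; apply/forallP => P; apply/implyP => /eqP P2.
apply/existsP; exists [ffun v => be_defense P v]; apply/andP; split.
  apply/forallP => -[l i]; apply/implyP; rewrite inE.
  rewrite !be_labelingE !ffunE => /andP[_ z]; apply/andP; split; last first.
    by case: l z.
  by case: l z => //= _; rewrite /be_defense /=; try case: ifP => _;
    apply: (Rpp_edge_adj (i := i)); rewrite // !inE eqxx ?orbT.
apply/forallP => v; apply/implyP; rewrite be_labelingE.
(* A label 2 allows one defended vertex; suppose [v] defends two, [u] and [w]. *)
case: (is_be v) => // _; rewrite leqNgt; apply/negP => /card_gt1P[u [w [+ + uw]]].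
rewrite !inE !be_labelingE !ffunE.
case/andP=> /andP[uP u0] /eqP uv /andP[/andP[wP w0]]; rewrite -{v}uv.
(* The attack is then exactly [u] and [w], which settles the membership tests in [be_defense]. *)
have {P2} PE x : (x \in P) = (x == u) || (x == w).
  suff /eqP -> : P == [set u; w] by rewrite !inE.
  by rewrite eq_sym eqEcard cards2 uw P2 subUset !sub1set uP wP.
rewrite /be_defense !PE => {uP wP PE}.
case: u w u0 w0 uw => [[] i] [[] j] //= _ _; rewrite !xpair_eqE /=.
all: try by move=> /negP ne /eqP E; apply: ne; rewrite ?E ?eqxx.
(* What remains pairs [a_i] with [c_j], or [f_i] with [d_j]. If [i = j], the second is sent to index
   [ordS i], not [i]; otherwise it keeps its own index [j], which differs from [i]. *)
all: rewrite ?orbF => _; have [->|ij /eqP ji] := eqVneq i j;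
  last by rewrite ji eqxx in ij.
all: by move=> /eqP E; case/eqP: (ordS_neq j n_gt1).
Qed.

End Rpp.

Theorem proposition2 (n : nat) (hn : 5 <= n) :
  ((gammaSRD 2 (Rpp n))%:Z =
     Num.ceil (((2 * #|Rpp n|)%N%:R / 3%:R)%R : rat))%R /\
  (Num.ceil (((2 * #|Rpp n|)%N%:R / 3%:R)%R : rat) = (4 * n)%N%:Z)%R.
Proof.
have ceilE : (Num.ceil (((2 * #|Rpp n|)%N%:R / 3%:R)%R : rat) = (4 * n)%N%:Z)%R.
  (* The quotient is an integer, so the ceiling leaves it unchanged. *)
  have -> : 2 * #|Rpp n| = 4 * n * 3 by rewrite card_Rpp; lia.
  by rewrite GRing.natrM GRing.mulfK // pmulrn Num.Theory.intrKceil.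
split=> //; rewrite ceilE; congr Posz; apply/eqP; rewrite eqn_leq.
have n_gt1 : 1 < n by apply: leq_trans hn.
rewrite -{1}weight_be_labeling gammaSRD_min ?be_labeling_proper //=.
have [f f_proper <-] := gammaSRD_attained 2 (Rpp n).
have := weight_ge f_proper _ (max_degree_Rpp n); rewrite card_Rpp; lia.
Qed.
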